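(* Let $K$ be a field of characteristic $2$ and let $\mathcal L=\mathrm{Lie}(v_1,v_2)\subset\mathrm{Der}\,R$ be the Fibonacci Lie algebra over $K$. Then $\mathcal L$ does not satisfy a nontrivial Lie identity; that is, there is no nonzero element $f(X_1,\dots,X_n)$ of a free Lie algebra over $K$ which vanishes under all substitutions of elements of $\mathcal L$ for $X_1,\dots,X_n$.
   Context: $R=K[t_i\mid i\ge 0]/(t_i^2\mid i\ge 0)$ is the truncated polynomial ring over $K$, and $\partial_i=\partial/\partial t_i\in\mathrm{Der}\,R$. The pivot elements are the derivations of $R$ $$v_i=\partial_i+t_{i-1}(\partial_{i+1}+t_i(\partial_{i+2}+t_{i+1}(\partial_{i+3}+\cdots))),\qquad i\ge 1,$$ so that $v_i=\partial_i+t_{i-1}v_{i+1}$ (the infinite sum acts on $R$ in a well-defined way). The Fibonacci Lie algebra $\mathcal L=\mathrm{Lie}(v_1,v_2)$ is the Lie subalgebra of $\mathrm{Der}\,R$ generated by $v_1,v_2$ (using the Lie bracket only). *)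

(* Defs.v *)
From HB Require Import structures.
From mathcomp Require Import all_boot all_algebra.
From mathcomp Require Import finmap generic_quotient.
From mathcomp Require Import boolp classical_sets functions cardinality fsbigop.
From mathcomp Require Import monalg.

Set Implicit Arguments.
Unset Strict Implicit.
Unset Printing Implicit Defensive.

Import GRing.Theory.
Local Open Scope ring_scope.
Local Open Scope quotient_scope.

HB.mixin Record Lmodule_isLieAlgebra (K : comNzRingType) L
    of GRing.Lmodule K L := {
  lieb : L -> L -> L;
  liebDl : forall x y z : L, lieb (x + y) z = lieb x z + lieb y z;
  liebDr : forall x y z : L, lieb x (y + z) = lieb x y + lieb x z;
  liebZl : forall (a : K) (x y : L), lieb (a *: x) y = a *: lieb x y;
  liebZr : forall (a : K) (x y : L), lieb x (a *: y) = a *: lieb x y;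
  liebb : forall x : L, lieb x x = 0;
  lieb_jacobi : forall x y z : L,
    lieb x (lieb y z) + lieb y (lieb z x) + lieb z (lieb x y) = 0
}.

#[short(type="lieAlgType")]
HB.structure Definition LieAlgebra (K : comNzRingType) :=
  {L of GRing.Lmodule K L & Lmodule_isLieAlgebra K L}.

Section LieSubalgebra.
Variables (K : comNzRingType) (L : lieAlgType K).

Definition lie_subalgebra (U : set L) : Prop :=
  [/\ U 0,
      forall x y, U x -> U y -> U (x + y),
      forall (a : K) x, U x -> U (a *: x)
    & forall x y, U x -> U y -> U (lieb x y)].

Definition lie_generated (S : set L) : set L := smallest lie_subalgebra S.

Lemma lie_generated_subalgebra (S : set L) : lie_subalgebra (lie_generated S).
Proof.
split=> [U [[]//]|x y Sx Sy U HU|a x Sx U HU|x y Sx Sy U HU];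
  have [[_ UD UZ UB] _] := HU.
- by apply: UD; [exact: Sx|exact: Sy].
- by apply: UZ; exact: Sx.
- by apply: UB; [exact: Sx|exact: Sy].
Qed.

End LieSubalgebra.

(* The free Lie algebra over K on I is the quotient of the formal Lie         *)
(* expressions by the least congruence containing the axioms of K-modules and *)
(* of Lie algebras.                                                           *)
Inductive lie_term (K I : Type) : Type :=
| LVar of I
| LZero
| LOpp of lie_term K I
| LAdd of lie_term K I & lie_term K I
| LScale of K & lie_term K I
| LBr of lie_term K I & lie_term K I.

Arguments LVar {K I}.
Arguments LZero {K I}.

HB.instance Definition _ (K I : Type) := gen_eqMixin (lie_term K I).
HB.instance Definition _ (K I : Type) := gen_choiceMixin (lie_term K I).

Inductive lie_cong (K : comNzRingType) (I : Type) :
    lie_term K I -> lie_term K I -> Prop :=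
| lc_refl s : lie_cong s s
| lc_sym s t : lie_cong s t -> lie_cong t s
| lc_trans s t u : lie_cong s t -> lie_cong t u -> lie_cong s u
| lc_opp s s' : lie_cong s s' -> lie_cong (LOpp s) (LOpp s')
| lc_add s s' t t' : lie_cong s s' -> lie_cong t t' ->
    lie_cong (LAdd s t) (LAdd s' t')
| lc_scale a s s' : lie_cong s s' -> lie_cong (LScale a s) (LScale a s')
| lc_br s s' t t' : lie_cong s s' -> lie_cong t t' ->
    lie_cong (LBr s t) (LBr s' t')
| lc_addA s t u : lie_cong (LAdd s (LAdd t u)) (LAdd (LAdd s t) u)
| lc_addC s t : lie_cong (LAdd s t) (LAdd t s)
| lc_add0 s : lie_cong (LAdd LZero s) s
| lc_addN s : lie_cong (LAdd (LOpp s) s) LZero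
| lc_scaleA a b s : lie_cong (LScale a (LScale b s)) (LScale (a * b) s)
| lc_scale1 s : lie_cong (LScale 1 s) s
| lc_scaleDr a s t :
    lie_cong (LScale a (LAdd s t)) (LAdd (LScale a s) (LScale a t))
| lc_scaleDl a b s :
    lie_cong (LScale (a + b) s) (LAdd (LScale a s) (LScale b s))
| lc_brDl s t u : lie_cong (LBr (LAdd s t) u) (LAdd (LBr s u) (LBr t u))
| lc_brDr s t u : lie_cong (LBr s (LAdd t u)) (LAdd (LBr s t) (LBr s u))
| lc_brZl a s t : lie_cong (LBr (LScale a s) t) (LScale a (LBr s t))
| lc_brZr a s t : lie_cong (LBr s (LScale a t)) (LScale a (LBr s t))
| lc_brss s : lie_cong (LBr s s) LZero
| lc_jacobi s t u :
    lie_cong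
      (LAdd (LAdd (LBr s (LBr t u)) (LBr t (LBr u s))) (LBr u (LBr s t)))
      LZero.

Section FreeLie.
Variables (K : comNzRingType) (I : Type).
Local Notation T := (lie_term K I).

Definition lie_congb (s t : T) : bool := `[< lie_cong s t >].

Lemma lie_congb_equiv : equiv_class_of lie_congb.
Proof.
split=> [s|s t|t s u]; first by apply/asboolP; exact: lc_refl.
  by apply/asboolP/asboolP; exact: lc_sym.
by move=> /asboolP st /asboolP tu; apply/asboolP; exact: lc_trans st tu.
Qed.

Canonical lie_congb_equivRel := EquivRelPack lie_congb_equiv.
Canonical lie_congb_encModRel := defaultEncModRel lie_congb.

Definition freeLie := {eq_quot lie_congb}.

HB.instance Definition _ := Choice.on freeLie.
HB.instance Definition _ : EqQuotient _ lie_congb freeLie :=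
  EqQuotient.on freeLie.

Local Notation cls := (\pi_freeLie).

Lemma freeLie_eqP (s t : T) : reflect (lie_cong s t) (cls s == cls t).
Proof. by rewrite piE; exact: asboolP. Qed.

Lemma freeLie_eq (s t : T) : lie_cong s t -> cls s = cls t.
Proof. by move=> /freeLie_eqP/eqP. Qed.

Lemma freeLie_repr (s : T) : lie_cong (repr (cls s)) s.
Proof. by apply/freeLie_eqP; rewrite reprK. Qed.

Definition fl_var (i : I) : freeLie := cls (LVar i).
Definition fl_opp : freeLie -> freeLie := lift_op1 freeLie (@LOpp K I).
Definition fl_add : freeLie -> freeLie -> freeLie :=
  lift_op2 freeLie (@LAdd K I).
Definition fl_scale (a : K) : freeLie -> freeLie :=
  lift_op1 freeLie (@LScale K I a).
Definition fl_br : freeLie -> freeLie -> freeLie :=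
  lift_op2 freeLie (@LBr K I).

Lemma fl_oppE s : fl_opp (cls s) = cls (LOpp s).
Proof. by unlock fl_opp; apply: freeLie_eq; apply: lc_opp; exact: freeLie_repr. Qed.
Lemma fl_addE s t : fl_add (cls s) (cls t) = cls (LAdd s t).
Proof. by unlock fl_add; apply: freeLie_eq; apply: lc_add; exact: freeLie_repr. Qed.
Lemma fl_scaleE a s : fl_scale a (cls s) = cls (LScale a s).
Proof. by unlock fl_scale; apply: freeLie_eq; apply: lc_scale; exact: freeLie_repr. Qed.
Lemma fl_brE s t : fl_br (cls s) (cls t) = cls (LBr s t).
Proof. by unlock fl_br; apply: freeLie_eq; apply: lc_br; exact: freeLie_repr. Qed.

Local Notation flE := (fl_oppE, fl_addE, fl_scaleE, fl_brE).

Lemma fl_addA : associative fl_add.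
Proof.
by elim/quotW=> s; elim/quotW=> t; elim/quotW=> u; rewrite !flE;
  apply: freeLie_eq; constructor.
Qed.
Lemma fl_addC : commutative fl_add.
Proof.
by elim/quotW=> s; elim/quotW=> t; rewrite !flE; apply: freeLie_eq;
  exact: lc_addC.
Qed.
Lemma fl_add0 : left_id (cls LZero) fl_add.
Proof. by elim/quotW=> s; rewrite !flE; apply: freeLie_eq; exact: lc_add0. Qed.
Lemma fl_addN : left_inverse (cls LZero) fl_opp fl_add.
Proof. by elim/quotW=> s; rewrite !flE; apply: freeLie_eq; exact: lc_addN. Qed.

HB.instance Definition _ :=
  GRing.isZmodule.Build freeLie fl_addA fl_addC fl_add0 fl_addN.

Lemma freeLie0E : cls LZero = 0. Proof. by []. Qed.
Lemma freeLieNE s : cls (LOpp s) = - cls s. Proof. by rewrite -flE. Qed.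
Lemma freeLieDE s t : cls (LAdd s t) = cls s + cls t.
Proof. by rewrite -flE. Qed.

Lemma fl_scaleA a b (x : freeLie) :
  fl_scale a (fl_scale b x) = fl_scale (a * b) x.
Proof. by elim/quotW: x => s; rewrite !flE; apply: freeLie_eq; constructor. Qed.
Lemma fl_scale1 : left_id 1 fl_scale.
Proof. by elim/quotW=> s; rewrite !flE; apply: freeLie_eq; exact: lc_scale1. Qed.
Lemma fl_scaleDr : right_distributive fl_scale +%R.
Proof.
move=> a; elim/quotW=> s; elim/quotW=> t; rewrite -freeLieDE !flE -freeLieDE.
by apply: freeLie_eq; exact: lc_scaleDr.
Qed.
Lemma fl_scaleDl (x : freeLie) : {morph fl_scale^~ x : a b / a + b}.
Proof.
elim/quotW: x => s a b; rewrite !flE -freeLieDE.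
by apply: freeLie_eq; exact: lc_scaleDl.
Qed.

HB.instance Definition _ := GRing.Zmodule_isLmodule.Build K freeLie
  fl_scaleA fl_scale1 fl_scaleDr fl_scaleDl.

Lemma freeLieZE a s : cls (LScale a s) = a *: cls s.
Proof. by rewrite -flE. Qed.

Lemma fl_brDl (x y z : freeLie) : fl_br (x + y) z = fl_br x z + fl_br y z.
Proof.
elim/quotW: x => s; elim/quotW: y => t; elim/quotW: z => u.
rewrite -freeLieDE !flE -freeLieDE; apply: freeLie_eq; exact: lc_brDl.
Qed.
Lemma fl_brDr (x y z : freeLie) : fl_br x (y + z) = fl_br x y + fl_br x z.
Proof.
elim/quotW: x => s; elim/quotW: y => t; elim/quotW: z => u.
rewrite -freeLieDE !flE -freeLieDE; apply: freeLie_eq; exact: lc_brDr.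
Qed.
Lemma fl_brZl a (x y : freeLie) : fl_br (a *: x) y = a *: fl_br x y.
Proof.
elim/quotW: x => s; elim/quotW: y => t.
rewrite -freeLieZE !flE -freeLieZE; apply: freeLie_eq; exact: lc_brZl.
Qed.
Lemma fl_brZr a (x y : freeLie) : fl_br x (a *: y) = a *: fl_br x y.
Proof.
elim/quotW: x => s; elim/quotW: y => t.
rewrite -freeLieZE !flE -freeLieZE; apply: freeLie_eq; exact: lc_brZr.
Qed.
Lemma fl_brxx (x : freeLie) : fl_br x x = 0.
Proof.
by elim/quotW: x => s; rewrite flE; apply: freeLie_eq; exact: lc_brss.
Qed.
Lemma fl_jacobi (x y z : freeLie) :
  fl_br x (fl_br y z) + fl_br y (fl_br z x) + fl_br z (fl_br x y) = 0.
Proof.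
elim/quotW: x => s; elim/quotW: y => t; elim/quotW: z => u.
by rewrite !flE -!freeLieDE; apply: freeLie_eq; exact: lc_jacobi.
Qed.

HB.instance Definition _ := Lmodule_isLieAlgebra.Build K freeLie
  fl_brDl fl_brDr fl_brZl fl_brZr fl_brxx fl_jacobi.

Lemma freeLieBE s t : cls (LBr s t) = lieb (cls s) (cls t).
Proof. by rewrite -flE. Qed.

Section Eval.
Variables (L : lieAlgType K) (a : I -> L).

Fixpoint lie_term_eval (s : T) : L :=
  match s with
  | LVar i => a i
  | LZero => 0
  | LOpp s => - lie_term_eval s
  | LAdd s t => lie_term_eval s + lie_term_eval t
  | LScale c s => c *: lie_term_eval s
  | LBr s t => lieb (lie_term_eval s) (lie_term_eval t)
  end.

Lemma lie_term_eval_cong s t :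
  lie_cong s t -> lie_term_eval s = lie_term_eval t.
Proof.
elim=> //=; try by intros; congruence.
- by move=> *; rewrite addrA.
- by move=> *; rewrite addrC.
- by move=> *; rewrite add0r.
- by move=> *; rewrite addNr.
- by move=> *; rewrite scalerA.
- by move=> *; rewrite scale1r.
- by move=> *; rewrite scalerDr.
- by move=> *; rewrite scalerDl.
- by move=> *; rewrite liebDl.
- by move=> *; rewrite liebDr.
- by move=> *; rewrite liebZl.
- by move=> *; rewrite liebZr.
- by move=> *; rewrite liebb.
- by move=> *; rewrite lieb_jacobi.
Qed.

Definition lie_eval (f : freeLie) : L := lie_term_eval (repr f).

Lemma lie_eval_pi s : lie_eval (cls s) = lie_term_eval s.
Proof. by apply: lie_term_eval_cong; exact: freeLie_repr. Qed.

Lemma lie_eval_var i : lie_eval (fl_var i) = a i.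
Proof. exact: lie_eval_pi. Qed.

Lemma lie_eval_is_linear : linear lie_eval.
Proof.
move=> c; elim/quotW=> s; elim/quotW=> t.
by rewrite -freeLieZE -freeLieDE !lie_eval_pi.
Qed.

HB.instance Definition _ :=
  GRing.isLinear.Build K freeLie L *:%R lie_eval lie_eval_is_linear.

Lemma lie_eval_br x y : lie_eval (lieb x y) = lieb (lie_eval x) (lie_eval y).
Proof.
by elim/quotW: x => s; elim/quotW: y => t; rewrite -freeLieBE !lie_eval_pi.
Qed.

Lemma lie_eval_unique (phi : {linear freeLie -> L}) :
  (forall x y, phi (lieb x y) = lieb (phi x) (phi y)) ->
  (forall i, phi (fl_var i) = a i) -> phi =1 lie_eval.
Proof.
move=> phiB phiV; elim/quotW; elim=> [i||s IH|s IHs t IHt|c s IH|s IHs t IHt].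
- by rewrite phiV lie_eval_var.
- by rewrite freeLie0E !linear0.
- by rewrite freeLieNE !linearN IH.
- by rewrite freeLieDE !linearD IHs IHt.
- by rewrite freeLieZE !linearZ /= IH.
- by rewrite freeLieBE phiB lie_eval_br IHs IHt.
Qed.

End Eval.
End FreeLie.

Section Derivations.
Variables (K : comNzRingType) (A : algType K).

Definition derivation (D : A -> A) : Prop :=
  linear D /\ forall x y : A, D (x * y) = D x * y + x * D y.

Definition der_pred : {pred A -> A} := fun D => `[< derivation D >].

Record der := Der { der_fun :> A -> A; _ : der_fun \in der_pred }.
Arguments der_fun : simpl never.

HB.instance Definition _ := [isSub for der_fun].
HB.instance Definition _ := [Choice of der by <:].

Lemma derP (D : der) : derivation D.
Proof. by case: D => D DP; apply/asboolP. Qed.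

Lemma der_pred_submod_closed : submod_closed der_pred.
Proof.
split.
  apply/asboolP; split=> [c x y|x y]; rewrite /GRing.zero /=.
    by rewrite scaler0 addr0.
  by rewrite mul0r mulr0 addr0.
move=> c D E /asboolP[Dl DM] /asboolP[El EM].
have E0 x : (c *: D + E) x = c *: D x + E x by [].
apply/asboolP; split=> [b x y|x y]; rewrite !E0.
  rewrite Dl El !scalerDr !scalerA [c * b]mulrC !addrA; congr (_ + _).
  by rewrite addrAC.
rewrite DM EM scalerDr mulrDl mulrDr -scalerAl -scalerAr !addrA.
by congr (_ + _); rewrite addrAC.
Qed.

HB.instance Definition _ :=
  GRing.isSubmodClosed.Build K (A -> A) der_pred der_pred_submod_closed.
HB.instance Definition _ := [SubChoice_isSubLmodule of der by <:].

Lemma der_br_subproof (D E : der) :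
  (fun x => D (E x) - E (D x)) \in der_pred.
Proof.
have [Dl DM] := derP D; have [El EM] := derP E.
have DD x y : D (x + y) = D x + D y by have := Dl 1 x y; rewrite !scale1r.
have ED x y : E (x + y) = E x + E y by have := El 1 x y; rewrite !scale1r.
apply/asboolP; split=> [c x y|x y].
  by rewrite El Dl El Dl opprD scalerBr addrACA.
rewrite EM DM !DD !ED !DM !EM mulrBl mulrBr.
set p := D (E x) * y; set q := x * D (E y); set r := E (D x) * y.
set s := x * E (D y); set u := E x * D y; set w := D x * E y.
rewrite [w + q]addrC (addrACA p) [u + s]addrC (addrACA r) [w + u]addrC.
by rewrite opprD (addrACA (p + q)) subrr addr0 opprD (addrACA p).
Qed.

Definition der_br (D E : der) : der := Der (der_br_subproof D E).

Lemma der_eqP (D E : der) : (D : A -> A) =1 E -> D = E.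
Proof. by move=> DE; apply/val_inj/funext. Qed.

Lemma derDE (D E : der) x : (D + E) x = D x + E x. Proof. by []. Qed.
Lemma derZE a (D : der) x : (a *: D) x = a *: D x. Proof. by []. Qed.
Lemma der0E x : (0 : der) x = 0. Proof. by []. Qed.
Lemma der_brE (D E : der) x : der_br D E x = D (E x) - E (D x).
Proof. by []. Qed.

HB.instance Definition _ (D : der) :=
  GRing.isLinear.Build K A A *:%R (der_fun D) (derP D).1.

Lemma derL (D : der) a x y : D (a *: x + y) = a *: D x + D y.
Proof. exact: (derP D).1. Qed.

Lemma derM (D : der) x y : D (x * y) = D x * y + x * D y.
Proof. exact: (derP D).2. Qed.

Lemma der_brDl (x y z : der) : der_br (x + y) z = der_br x z + der_br y z.
Proof.
by apply: der_eqP => u; rewrite derDE !der_brE !derDE linearD opprD addrACA.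
Qed.
Lemma der_brDr (x y z : der) : der_br x (y + z) = der_br x y + der_br x z.
Proof.
by apply: der_eqP => u; rewrite derDE !der_brE !derDE linearD opprD addrACA.
Qed.
Lemma der_brZl a (x y : der) : der_br (a *: x) y = a *: der_br x y.
Proof.
by apply: der_eqP => u; rewrite derZE !der_brE !derZE linearZ scalerBr.
Qed.
Lemma der_brZr a (x y : der) : der_br x (a *: y) = a *: der_br x y.
Proof.
by apply: der_eqP => u; rewrite derZE !der_brE !derZE linearZ scalerBr.
Qed.
Lemma der_brxx (x : der) : der_br x x = 0.
Proof. by apply: der_eqP => u; rewrite der_brE subrr. Qed.
Lemma der_jacobi (x y z : der) :
  der_br x (der_br y z) + der_br y (der_br z x) + der_br z (der_br x y) = 0.
Proof.
apply: der_eqP => u; rewrite !derDE !der_brE der0E !linearB /= !opprK.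
set a := x (y (z u)); set b := x (z (y u)); set c := y (z (x u)).
set d := z (y (x u)); set e := y (x (z u)); set f := z (x (y u)).
rewrite (AC ((2*2)*(2*2)*(2*2)) ((1*11)*(2*8)*(3*5)*(4*10)*(6*12)*(7*9))).
by rewrite /= !subrr !addNr !addr0.
Qed.

HB.instance Definition _ := Lmodule_isLieAlgebra.Build K der
  der_brDl der_brDr der_brZl der_brZr der_brxx der_jacobi.

Lemma der_liebE (D E : der) x : lieb D E x = D (E x) - E (D x).
Proof. by []. Qed.

End Derivations.
Arguments der_fun : simpl never.

Section GeneratedIdeal.
Variables (R : comNzRingType) (I : Type) (g : I -> R).

Definition gen_ideal : {pred R} := fun p =>
  `[< exists s : seq (R * I), p = \sum_(x <- s) x.1 * g x.2 >].

Lemma gen_ideal_closed : 1 \notin gen_ideal -> idealr_closed gen_ideal.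
Proof.
move=> n1; split=> // [|a p q /asboolP[s ->] /asboolP[r ->]].
  by apply/asboolP; exists [::]; rewrite big_nil.
apply/asboolP; exists ([seq (a * x.1, x.2) | x <- s] ++ r).
rewrite big_cat big_map mulr_sumr; congr (_ + _).
by apply: eq_bigr => x _; rewrite mulrA.
Qed.

Lemma gen_ideal_gen i : g i \in gen_ideal.
Proof. by apply/asboolP; exists [:: (1, i)]; rewrite big_seq1 mul1r. Qed.

Lemma gen_ideal_stable (d : R -> R) : {morph d : p q / p + q} -> d 0 = 0 ->
  (forall p q, d (p * q) = d p * q + p * d q) -> (forall i, d (g i) = 0) ->
  {homo d : p / p \in gen_ideal}.
Proof.
move=> dD d0 dM dg p /asboolP[s ->]; apply/asboolP.
exists [seq (d x.1, x.2) | x <- s]; rewrite big_map (big_morph d dD d0).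
by apply: eq_bigr => x _; rewrite dM dg mulr0 addr0.
Qed.

End GeneratedIdeal.

Section QuotientAlgebra.
Variables (K : comNzRingType) (P : comAlgType K) (J : idealr P).

Definition quot_alg := {ideal_quot J}.

HB.instance Definition _ := GRing.ComNzRing.on quot_alg.

Definition qproj (p : P) : quot_alg := \pi_{ideal_quot J} p.

Lemma qproj_is_zmod : zmod_morphism qproj.
Proof. exact: rmorphB. Qed.
Lemma qproj_is_monoid : monoid_morphism qproj.
Proof. by split; [exact: rmorph1|exact: rmorphM]. Qed.

HB.instance Definition _ :=
  GRing.isZmodMorphism.Build P quot_alg qproj qproj_is_zmod.
HB.instance Definition _ :=
  GRing.isMonoidMorphism.Build P quot_alg qproj qproj_is_monoid.

Lemma qproj_eq p q : (qproj p == qproj q) = (p - q \in J).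
Proof. by rewrite Quotient.idealrBE. Qed.

Lemma qproj_eq0 p : (qproj p == 0) = (p \in J).
Proof. by rewrite -(rmorph0 qproj) qproj_eq subr0. Qed.

Lemma qprojK (x : quot_alg) : qproj (repr x) = x.
Proof. exact: reprK. Qed.

Lemma qproj_surj (x : quot_alg) : exists p, x = qproj p.
Proof. by exists (repr x); rewrite qprojK. Qed.

Definition quot_scale (a : K) (x : quot_alg) : quot_alg := qproj a%:A * x.

Lemma quot_scaleA a b x : quot_scale a (quot_scale b x) = quot_scale (a * b) x.
Proof. by rewrite /quot_scale mulrA -rmorphM /= -scalerAl mul1r scalerA. Qed.
Lemma quot_scale1 : left_id 1 quot_scale.
Proof. by move=> x; rewrite /quot_scale scale1r rmorph1 mul1r. Qed.
Lemma quot_scaleDr : right_distributive quot_scale +%R.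
Proof. by move=> a x y; rewrite /quot_scale mulrDr. Qed.
Lemma quot_scaleDl x : {morph quot_scale^~ x : a b / a + b}.
Proof. by move=> a b; rewrite /quot_scale scalerDl rmorphD mulrDl. Qed.

HB.instance Definition _ := GRing.Zmodule_isLmodule.Build K quot_alg
  quot_scaleA quot_scale1 quot_scaleDr quot_scaleDl.

Lemma quot_scaleAl a (x y : quot_alg) : a *: (x * y) = (a *: x) * y.
Proof. exact: mulrA. Qed.

HB.instance Definition _ :=
  GRing.Lmodule_isLalgebra.Build K quot_alg quot_scaleAl.
HB.instance Definition _ := GRing.Lalgebra_isComAlgebra.Build K quot_alg.

Lemma qprojZ a p : qproj (a *: p) = a *: qproj p.
Proof. by rewrite -[p in LHS]mul1r scalerAl rmorphM. Qed.

Lemma quot_der_subproof (d : der P) : {homo d : p / p \in J} ->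
  (fun x : quot_alg => qproj (d (repr x))) \in @der_pred K quot_alg.
Proof.
move=> dJ; set D := fun x => _.
have DE p : D (qproj p) = qproj (d p).
  apply/eqP; rewrite qproj_eq -linearB; apply: dJ.
  by rewrite -qproj_eq qprojK.
apply/asboolP; split=> [c x y|x y];
  have [p ->] := qproj_surj x; have [q ->] := qproj_surj y.
  by rewrite -qprojZ -rmorphD !DE linearP rmorphD /= qprojZ.
by rewrite -rmorphM !DE derM rmorphD !rmorphM.
Qed.

Definition quot_der (d : der P) (dJ : {homo d : p / p \in J}) : der quot_alg :=
  Der (quot_der_subproof dJ).

Lemma quot_derE (d : der P) (dJ : {homo d : p / p \in J}) p :
  quot_der dJ (qproj p) = qproj (d p).
Proof.
apply/eqP; rewrite qproj_eq -linearB; apply: dJ.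
by rewrite -qproj_eq qprojK.
Qed.

End QuotientAlgebra.

Lemma leibniz_sum (R : pzRingType) (d : R -> R) (S T : Type)
    (r : seq S) (s : seq T) (F : S -> R) (G : T -> R) :
  {morph d : p q / p + q} -> d 0 = 0 ->
  (forall i j, d (F i * G j) = d (F i) * G j + F i * d (G j)) ->
  d ((\sum_(i <- r) F i) * \sum_(j <- s) G j) =
  d (\sum_(i <- r) F i) * (\sum_(j <- s) G j) +
  (\sum_(i <- r) F i) * d (\sum_(j <- s) G j).
Proof.
move=> dD d0 dFG; elim/big_rec: _ => [|i x _ IH].
  by rewrite !(mul0r, d0) add0r.
rewrite mulrDl !dD IH !mulrDl addrACA; congr (_ + _).
elim/big_rec: _ {IH x} => [|j y _ IH]; first by rewrite !(mulr0, d0) addr0.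
by rewrite mulrDr !dD IH dFG !mulrDr addrACA.
Qed.

Section Pivot.
Variables (K : comNzRingType) (A : comAlgType K).
Variables (t : nat -> A) (d : nat -> der A).
Hypothesis d_fin : forall x, exists N, forall i, (N <= i)%N -> d i x = 0.

(* The nested sum d_i + t_(i-1) (d_(i+1) + t_i (d_(i+2) + ...)), expanded as  *)
(* \sum_k t_(i-1) t_i ... t_(i+k-2) d_(i+k).  At each x only finitely many    *)
(* terms are nonzero.  The index i is meant to be positive.                   *)
Definition pivot_sum_fun (i : nat) (x : A) : A :=
  \sum_(k \in [set: nat]) (\prod_(j < k) t (i.-1 + j)) * d (i + k) x.

Lemma pivot_sum_funE i x N : (forall k, (N <= k)%N -> d k x = 0) ->
  pivot_sum_fun i x =
  \sum_(k < N) (\prod_(j < k) t (i.-1 + j)) * d (i + k) x.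
Proof.
move=> xN; rewrite /pivot_sum_fun -(fsbig_widen [set` iota 0 N] setT) //.
  rewrite -fsbig_seq ?iota_uniq //.
  by rewrite -(big_mkord xpredT (fun k =>
    (\prod_(j < k) t (i.-1 + j)) * d (i + k) x)) /index_iota subn0.
move=> k [_ kN]; have Nk : (N <= k)%N.
  by rewrite leqNgt; apply/negP => ltkN; apply: kN; rewrite /= mem_iota.
by rewrite /preimage /mkset xN ?mulr0 // (leq_trans Nk) // leq_addl.
Qed.

Lemma pivot_sum_der i : pivot_sum_fun i \in @der_pred K A.
Proof.
have bnd x y : exists N, forall k, (N <= k)%N ->
    d k x = 0 /\ d k y = 0.
  have [M HM] := d_fin x; have [N HN] := d_fin y.
  exists (maxn M N) => k; rewrite geq_max => /andP[Mk Nk].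
  by rewrite HM // HN.
apply/asboolP; split=> [c x y|x y]; have [N HN] := bnd x y.
  rewrite !(@pivot_sum_funE i _ N) => [|k /HN[]//|k /HN[]//|k /HN[x0 y0]]; last first.
    by rewrite derL x0 y0 scaler0 addr0.
  rewrite scaler_sumr -big_split; apply: eq_bigr => k _ /=.
  by rewrite derL mulrDr scalerAr.
rewrite !(@pivot_sum_funE i _ N) => [|k /HN[]//|k /HN[]//|k /HN[x0 y0]]; last first.
  by rewrite derM x0 y0 mulr0 mul0r addr0.
rewrite mulr_suml mulr_sumr -big_split; apply: eq_bigr => k _ /=.
by rewrite derM mulrDr mulrA [in RHS]mulrCA.
Qed.

Definition pivot_sum (i : nat) : der A := Der (pivot_sum_der i).

Lemma pivot_sumE i x : pivot_sum i x = pivot_sum_fun i x. Proof. by []. Qed.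

Lemma pivot_sum_rec i x :
  pivot_sum i.+1 x = d i.+1 x + t i * pivot_sum i.+2 x.
Proof.
have [N HN] := d_fin x.
rewrite !pivot_sumE (@pivot_sum_funE i.+1 _ N.+1) => [|k Nk]; last by rewrite HN // ltnW.
rewrite (@pivot_sum_funE i.+2 _ N) // big_ord_recl big_ord0 mul1r addn0.
congr (_ + _); rewrite mulr_sumr; apply: eq_bigr => k _ /=.
have -> : (i.+1 + lift ord0 k = i.+2 + k)%N by rewrite lift0 addnS.
rewrite mulrA; congr (_ * _); rewrite /bump leq0n add1n big_ord_recl addn0.
by congr (_ * _); apply: eq_bigr => j _; rewrite lift0 addSnnS.
Qed.

End Pivot.

Section TruncatedRing.
Variable K : fieldType.
Local Notation inf_poly := {malg K[{cmonom nat}]}.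

Definition pvar (i : nat) : inf_poly := << ucm i >>.

(* The partial derivative in the i-th variable; the monomial [divcm m (ucm i)] *)
(* is m / X_i when X_i divides m, and otherwise its coefficient is zero.      *)
Definition poly_partial_fun (i : nat) (p : inf_poly) : inf_poly :=
  \sum_(m <- msupp p) << p@_m *+ (m : {cmonom nat}) i *g divcm m (ucm i) >>.

Lemma poly_partial_wide i p (d : {fset {cmonom nat}}) : (msupp p `<=` d)%fset ->
  poly_partial_fun i p =
  \sum_(m <- d) << p@_m *+ (m : {cmonom nat}) i *g divcm m (ucm i) >>.
Proof.
move=> pd; rewrite /poly_partial_fun; apply: big_fset_incl => // m _ mp.
by rewrite (mcoeff_outdom mp) mul0rn monalgU0.
Qed.

Lemma poly_partialD i : {morph poly_partial_fun i : p q / p + q}.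
Proof.
move=> p q; set d := (msupp p `|` msupp q)%fset.
rewrite !(@poly_partial_wide i _ d) ?fsubsetUl ?fsubsetUr ?msuppD_le //.
rewrite -big_split; apply: eq_bigr => m _.
by rewrite mcoeffD mulrnDl monalgUD.
Qed.

Lemma poly_partialZ i c p :
  poly_partial_fun i (c *: p) = c *: poly_partial_fun i p.
Proof.
rewrite (poly_partial_wide i (msuppZ_le c p)) raddf_sum.
apply: eq_bigr => m _; apply/malgP => k /=.
by rewrite !(mcoeffU, mcoeffZ) !mulrnAr.
Qed.

Lemma poly_partialU i c (m : {cmonom nat}) :
  poly_partial_fun i << c *g m >> = << c *+ m i *g divcm m (ucm i) >>.
Proof. by rewrite (poly_partial_wide i msuppU_le) big_seq_fset1 mcoeffUU. Qed.

Lemma monomM (a b : K) (m n : {cmonom nat}) :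
  << a *g m >> * << b *g n >> = << a * b *g mmul m n >> :> inf_poly.
Proof. exact: fgmulUU. Qed.

Lemma divcmM i (m n : {cmonom nat}) : (0 < m i)%N ->
  divcm (mmul m n) (ucm i) = mmul (divcm m (ucm i)) n.
Proof.
move=> mi; apply/eqP/cmP => j; rewrite cmM !divcmE cmM ucmE.
by have [<-|] := eqVneq i j; rewrite ?subn0 // addnBAC.
Qed.

Lemma poly_partialMU i (a b : K) (m n : {cmonom nat}) :
  poly_partial_fun i (<< a *g m >> * << b *g n >>) =
  poly_partial_fun i << a *g m >> * << b *g n >> +
  << a *g m >> * poly_partial_fun i << b *g n >>.
Proof.
pose F (x y : inf_poly) := x * << b *g n >> + << a *g m >> * y.
apply: etrans (esym (congr2 F (poly_partialU i a m) (poly_partialU i b n))).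
apply: etrans (congr1 (poly_partial_fun i) (monomM a b m n)) _.
apply: etrans (poly_partialU i (a * b) (mmul m n)) _.
apply: etrans (esym (congr2 +%R (monomM _ _ _ _) (monomM _ _ _ _))).
rewrite mulrnAl mulrnAr cmM mulrnDr.
apply: etrans (monalgUD (divcm (mmul m n) (ucm i)) (a * b *+ m i) (a * b *+ n i)) _.
apply: congr2.
  have [->|m0] := posnP (m i); first by rewrite !mulr0n !monalgU0.
  by rewrite divcmM.
have [->|n0] := posnP (n i); first by rewrite !mulr0n !monalgU0.
by rewrite (mulmC m n) (divcmM m n0) (mulmC _ m).
Qed.

Lemma poly_partialM i p q : poly_partial_fun i (p * q) =
  poly_partial_fun i p * q + p * poly_partial_fun i q.
Proof.
rewrite [p]monalgE [q]monalgE; apply: leibniz_sum => [||m n].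
- exact: poly_partialD.
- by rewrite /poly_partial_fun msupp0 big_seq_fset0.
- exact: poly_partialMU.
Qed.

Lemma poly_partial_der i : poly_partial_fun i \in @der_pred K inf_poly.
Proof.
apply/asboolP; split=> [c p q|]; last exact: poly_partialM.
by rewrite poly_partialD poly_partialZ.
Qed.

Definition poly_partial (i : nat) : der inf_poly := Der (poly_partial_der i).

Lemma poly_partial_var i j : poly_partial i (pvar j) = (i == j)%:R.
Proof.
rewrite [LHS]poly_partialU ucmE eq_sym.
have [->|_] := eqVneq i j; last by rewrite monalgU0.
have -> : divcm (ucm j) (ucm j) = mone :> {cmonom nat}.
  by apply/eqP/cmP => k; rewrite divcmE subnn cm1.
by [].
Qed.

Lemma poly_partial_bound p : exists N, forall i, (N <= i)%N ->
  poly_partial i p = 0.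
Proof.
exists (\max_(m <- msupp p) \max_(j <- finsupp (m : {cmonom nat})) j.+1)%N.
move=> i Ni; rewrite [LHS]big_seq big1 // => m mp.
suff -> : (m : {cmonom nat}) i = 0%N by rewrite mulr0n monalgU0.
apply/eqP; rewrite cmE_eq0; apply/negP => im.
have : (i.+1 <= i)%N; last by rewrite ltnn.
apply: leq_trans Ni.
apply: (@leq_trans (\max_(j <- finsupp (m : {cmonom nat})) j.+1)%N).
  exact: (@leq_bigmax_seq _ _ _ (fun j : nat => j.+1)).
exact: (@leq_bigmax_seq _ _ _
  (fun m : {cmonom nat} => \max_(j <- finsupp m) j.+1)%N).
Qed.

Definition sq_ideal : {pred inf_poly} := gen_ideal (fun i => pvar i ^+ 2).

Lemma sq_ideal_proper : 1 \notin sq_ideal.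
Proof.
apply/negP => /asboolP[s eq1].
move: (congr1 (mcoeff mone) eq1); rewrite rmorph1 raddf_sum.
rewrite big1 => [/eqP|x _]; first by rewrite oner_eq0.
by rewrite /= (mcoeff1g_is_multiplicative _ _).1 rmorphXn /= mcoeffU cm1_eq1
           expr0n mulr0.
Qed.

HB.instance Definition _ :=
  isIdealr.Build inf_poly sq_ideal (gen_ideal_closed sq_ideal_proper).

Definition truncR : comAlgType K := quot_alg sq_ideal.

Definition tvar (i : nat) : truncR := qproj sq_ideal (pvar i).

Lemma tvar_sqr i : tvar i ^+ 2 = 0.
Proof.
by apply/eqP; rewrite -rmorphXn qproj_eq0; exact: (@gen_ideal_gen _ _ _ i).
Qed.

Hypothesis char2 : 2%N \in [pchar K].

Lemma poly_partial_sq_ideal i : {homo poly_partial i : p / p \in sq_ideal}.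
Proof.
apply: gen_ideal_stable => [p q||p q|j].
- exact: linearD.
- exact: linear0.
- exact: derM.
rewrite expr2 derM mulrC -mulr2n -scaler_nat.
by rewrite (eqP (proj2 (andP char2))) scale0r.
Qed.

Definition partial (i : nat) : der truncR := quot_der (@poly_partial_sq_ideal i).

Lemma partial_tvar i j : partial i (tvar j) = (i == j)%:R.
Proof. by rewrite quot_derE poly_partial_var rmorph_nat. Qed.

Lemma partial_bound x : exists N, forall i, (N <= i)%N -> partial i x = 0.
Proof.
have [p ->] := qproj_surj x; have [N HN] := poly_partial_bound p.
by exists N => i /HN pi0; rewrite quot_derE pi0 rmorph0.
Qed.

Definition pivot (i : nat) : der truncR := pivot_sum tvar partial_bound i.

Lemma pivot_rec i x :
  pivot i.+1 x = partial i.+1 x + tvar i * pivot i.+2 x.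
Proof. exact: pivot_sum_rec. Qed.

Definition fibonacci_lie : set (der truncR) :=
  lie_generated [set pivot 1; pivot 2].

End TruncatedRing.

(* Main.v *)
From HB Require Import structures.
From mathcomp Require Import all_boot all_order all_algebra.
From mathcomp Require Import finmap generic_quotient.
From mathcomp Require Import boolp.
From mathcomp Require Import monalg.
Require Import Defs.

(* Every nonzero f in the free Lie algebra is a combination of bracketings of *)
(* Lyndon trees; the bracketing of a tree t is, in the free associative       *)
(* algebra, the word of t plus larger words of the same length.  So if w is   *)
(* the least word of a tree occurring in f, then w has a nonzero coefficient  *)
(* in the associative expansion of f.  On the other side, L contains          *)
(* [v_(4j+1), v_(4j+3)] = t_(4j) v_(4j+4), which acts on the linear forms     *)
(* modulo higher degree as the matrix unit sending t_(4j+4) to t_(4j).  Hence *)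
(* substituting for X_a the sum of these elements over the positions j at     *)
(* which w has the letter a, the coefficient of t_0 in f(t_(4|w|)) is exactly *)
(* the coefficient of w in f.                                                 *)

Set Implicit Arguments.
Unset Strict Implicit.
Unset Printing Implicit Defensive.

Import Order.TTheory GRing.Theory Order.DefaultSeqLexiOrder.

(** The derivations [shift j] act on linear coefficients as the matrix units $E_{j,j+1}$
    ([lincoeff_shift]), and such units compose along the single path $0\to1\to2\to\cdots$. After the
    substitution [word_der w], a product of variables therefore carries $t_{4|w|}$ to something with
    nonzero coefficient at $t_0$ precisely when its letters spell [w]. So $\mathcal L$ detects any
    chosen word in the associative expansion of $f$. It remains to choose a word that occurs. Jacobi
    rewriting shows that Lyndon bracketings span the free Lie algebra ([freeLie_lyndon_span]). A
    Lyndon tree is determined by its word ([yield_inj]), so among the trees with nonzero coefficient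
    in $f$ exactly one, [t0], has the least word. By [lincoeff_bracket] the other trees contribute
    nothing at that word, and [t0] contributes its own coefficient. *)

(** * Lyndon words in the lexicographic order *)

Section Words.
Local Open Scope order_scope.
Context {d : Order.disp_t} {I : orderType d}.
Implicit Types p q r s u v x y : seq I.

Lemma ltxi_cat2l p u v : (p ++ u < p ++ v) = (u < v).
Proof. by elim: p => //= a p IH; rewrite eqhead_ltxiE. Qed.

Lemma lexi_catr u x : u <= u ++ x.
Proof. by elim: u => [|a u IH] /=; rewrite ?eqhead_lexiE ?lexi0s. Qed.

(** The comparison is decided at the first letter where [u] and [v] differ, which the appended words
    do not touch. *)
Lemma ltxi_cat u v x y : ~~ prefix u v -> u < v -> u ++ x < v ++ y.
Proof.
elim: u v => [|a u IH] [|b v] //=; rewrite !ltxi_cons.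
have [->|ab] := eqVneq a b; first by rewrite lexx /=; exact: IH.
by case: (comparable_ltgtP (comparableT a b)) ab => //= ->; rewrite ?eqxx.
Qed.

Lemma prefix_size u v : (size v <= size u)%N -> u != v -> ~~ prefix u v.
Proof.
move=> suv nuv; apply: contra nuv => /prefixP[w vE]; move: suv.
rewrite vE size_cat -[leqRHS]addn0 leq_add2l leqn0 size_eq0 => /eqP->.
by rewrite cats0.
Qed.

Lemma ltxi_cat_size u v x y : (size v <= size u)%N -> u < v -> u ++ x < v ++ y.
Proof. by move=> suv uv; rewrite ltxi_cat ?prefix_size // lt_eqF. Qed.

Lemma lexi_cat_size u v x y :
  size u = size v -> u <= v -> x <= y -> u ++ x <= v ++ y.
Proof.
rewrite [u <= v]le_eqVlt => suv /predU1P[<-|uv].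
  by rewrite !le_eqVlt ltxi_cat2l => /predU1P[->|->]; rewrite ?eqxx ?orbT.
by move=> _; apply/ltW/ltxi_cat_size; rewrite // suv.
Qed.

Definition lyndon w :=
  forall p s : seq I, w = p ++ s -> p <> [::] -> s <> [::] -> w < s.

(** If [v = u ++ r], cancelling [u] leaves [v < r], true because [r] is a proper suffix of a Lyndon
    word; otherwise [u] and [v] already differ at a letter. *)
Lemma lyndon_lt_cat u v : u != [::] -> lyndon v -> u < v -> u ++ v < v.
Proof.
move=> u0 lv uv; have [pre|npre] := boolP (prefix u v).
  have [r vE] := prefixP pre.
  rewrite [ltRHS]vE ltxi_cat2l; apply: (lv _ _ vE); first exact/eqP.
  by move=> r0; rewrite vE r0 cats0 ltxx in uv.
by rewrite -[ltRHS]cats0; apply: ltxi_cat.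
Qed.

Lemma cat_suffix u v p s : u ++ v = p ++ s ->
  (exists2 q, u = p ++ q & s = q ++ v) \/ (exists2 q, p = u ++ q & v = q ++ s).
Proof.
elim: u p => [|a u IH] [|b p] /=.
- by move=> ->; left; exists [::].
- by move=> ->; right; exists (b :: p).
- by move=> <-; left; exists (a :: u).
by case=> -> /IH[[q -> ->]|[q -> ->]]; [left|right]; exists q.
Qed.

(** A suffix starting strictly inside [u] begins with a proper suffix [q] of [u], and [u < q] is
    decided within the shorter [q]. A suffix of [v] is at least [v], which exceeds [u ++ v]. *)
Lemma lyndon_cat u v : u != [::] -> lyndon u -> lyndon v -> u < v ->
  lyndon (u ++ v).
Proof.
move=> u0 lu lv uv p s /cat_suffix[[[|a q] uE ->]|[[|a q] _ vE]] p0 s0.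
- exact: lyndon_lt_cat.
- have uq : u < a :: q by exact: (lu _ _ uE p0).
  by apply: ltxi_cat_size; rewrite // uE size_cat leq_addl.
- by rewrite -[s]cat0s -vE; exact: lyndon_lt_cat.
- apply: lt_trans (lyndon_lt_cat u0 lv uv) _.
  exact: (lv _ _ vE).
Qed.

End Words.

(** * Lyndon trees, the standard bracketings of Lyndon words *)

Inductive bin_tree (I : Type) := Leaf of I | Node of bin_tree I & bin_tree I.

HB.instance Definition _ (I : Type) := gen_eqMixin (bin_tree I).

Fixpoint yield I (t : bin_tree I) : seq I :=
  match t with Leaf a => [:: a] | Node l r => yield l ++ yield r end.

Lemma yield_neq0 (I : eqType) (t : bin_tree I) : yield t != [::].
Proof. by elim: t => //= l IHl r _; case: (yield l) IHl. Qed.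

Lemma size_yield_gt0 I (t : bin_tree I) : (0 < size (yield t))%N.
Proof. by elim: t => //= l IHl r _; rewrite size_cat addn_gt0 IHl. Qed.

Section LyndonTrees.
Local Open Scope order_scope.
Context {d : Order.disp_t} {I : orderType d}.
Implicit Types t l r : bin_tree I.

(* The last condition says that [yield r] is the smallest proper suffix of    *)
(* [yield l ++ yield r], that is, the standard factorization.                 *)
Fixpoint lyndon_tree t : bool :=
  match t with
  | Leaf _ => true
  | Node l r => [&& lyndon_tree l, lyndon_tree r, yield l < yield r
      & if l is Node _ l2 then yield r <= yield l2 else true]
  end.

Lemma lyndon_treeP t : lyndon_tree t -> lyndon (yield t).
Proof.
elim: t => [a|l IHl r IHr] /=; first by move=> _ [|b [|c p]] [|e s].
case/and4P=> /IHl ll /IHr lr lt_lr _.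
by apply: lyndon_cat; rewrite ?yield_neq0.
Qed.

(** A suffix reaching into [l] is [q ++ yield r]. If [l] splits as [l1], [l2] and [q] is nonempty,
    induction gives [yield l2 <= q], and the last condition of [lyndon_tree] gives
    [yield r <= yield l2]. *)
Lemma lyndon_tree_min_suffix l r p s : lyndon_tree (Node l r) ->
  yield l ++ yield r = p ++ s -> p <> [::] -> s <> [::] -> yield r <= s.
Proof.
elim: l r p s => [a|l1 IH l2 _] r p s.
  case/and4P=> _ /lyndon_treeP lr _ _.
  case/cat_suffix=> [[q aE ->]|[[|b q] _ rE]] p0 s0.
  - have -> : q = [::] by case: p p0 aE => [|b [|c p]] // _ [_ <-].
    by [].
  - by rewrite rE.
  - by apply/ltW/(lr _ _ rE).
case/and4P=> ll /lyndon_treeP lr _ rl2.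
case/cat_suffix=> [[q lE ->]|[[|b q] _ rE]] p0 s0.
- have [->//|/eqP q0] := eqVneq q [::].
  apply: le_trans (lexi_catr q (yield r)).
  by apply: (le_trans rl2); exact: IH ll lE p0 q0.
- by rewrite rE.
- by apply/ltW/(lr _ _ rE).
Qed.

(** The smallest proper suffix depends on the word alone, so the word determines the split at the
    root, and recursively the tree. *)
Lemma yield_inj : {in lyndon_tree &, injective (@yield I)}.
Proof.
move=> t t'; rewrite !unfold_in; elim: t t' => [a|l IHl r IHr] [a'|l' r'] /=.
- by move=> _ _ [->].
- move=> _ _ /(congr1 size)/eqP; rewrite /= size_cat.
  by have := size_yield_gt0 l'; have := size_yield_gt0 r';
    case: (size _) => // m; case: (size _) => // k; rewrite addnS.
- move=> _ _ /(congr1 size)/eqP; rewrite /= size_cat.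
  by have := size_yield_gt0 l; have := size_yield_gt0 r;
    case: (size _) => // m; case: (size _) => // k; rewrite addnS.
move=> T T' E; have nz (x : bin_tree I) : yield x <> [::].
  by apply/eqP; exact: yield_neq0.
have rr : yield r = yield r'.
  apply: le_anti; rewrite (lyndon_tree_min_suffix T E) //=.
  exact: lyndon_tree_min_suffix T' (esym E) _ _.
move: (E) => /eqP; rewrite rr eqseq_cat ?eqxx ?andbT => [/eqP ll|]; last first.
  by move/(congr1 size): (E); rewrite !size_cat rr => /addIn.
case/and4P: T => Tl Tr _ _; case/and4P: T' => Tl' Tr' _ _.
by rewrite (IHl l') // (IHr r').
Qed.

End LyndonTrees.

(** * Identities in a Lie algebra *)

Section LieBracket.
Context {K : comNzRingType} {L : lieAlgType K}.
Implicit Types x y z : L.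
Local Open Scope ring_scope.

Lemma liebC x y : lieb x y = - lieb y x.
Proof.
apply/eqP; rewrite -addr_eq0; have := liebb (x + y).
by rewrite liebDl !liebDr !liebb addr0 add0r => ->.
Qed.

Lemma liebNr x y : lieb x (- y) = - lieb x y.
Proof. by rewrite -scaleN1r liebZr scaleN1r. Qed.

Lemma lieb0r x : lieb x 0 = 0.
Proof. by rewrite -(scale0r 0) liebZr !scale0r. Qed.

Lemma lieb_leibniz x y z :
  lieb (lieb x y) z = lieb x (lieb y z) - lieb y (lieb x z).
Proof.
have /eqP := lieb_jacobi x y z; rewrite addr_eq0 => /eqP E.
by rewrite (liebC _ z) -E (liebC z x) liebNr.
Qed.

End LieBracket.

(** * Lyndon bracketings span the free Lie algebra *)

Section LyndonSpan.
Context {K : comNzRingType} {d : Order.disp_t} {I : finOrderType d}.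
Implicit Types (t l r : bin_tree I) (P Q : pred (bin_tree I)).
Implicit Types f g : freeLie K I.
Local Open Scope ring_scope.

Fixpoint bracket t : freeLie K I :=
  match t with
  | Leaf a => fl_var K a
  | Node l r => lieb (bracket l) (bracket r)
  end.

Definition tree_span P f : Prop :=
  exists2 s : seq (K * bin_tree I), all (fun x => P x.2) s &
    f = \sum_(x <- s) x.1 *: bracket x.2.

Lemma tree_span0 P : tree_span P 0.
Proof. by exists [::]; rewrite ?big_nil. Qed.

Lemma tree_spanD P f g : tree_span P f -> tree_span P g -> tree_span P (f + g).
Proof.
move=> [s Ps ->] [s' Ps' ->].
by exists (s ++ s'); rewrite ?all_cat ?Ps // big_cat.
Qed.

Lemma tree_spanZ P a f : tree_span P f -> tree_span P (a *: f).
Proof.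
move=> [s Ps ->].
exists [seq (a * x.1, x.2) | x <- s]; first by rewrite all_map.
by rewrite big_map scaler_sumr; apply: eq_bigr => x _; rewrite scalerA.
Qed.

Lemma tree_spanN P f : tree_span P f -> tree_span P (- f).
Proof. by rewrite -scaleN1r; exact: tree_spanZ. Qed.

Lemma tree_span_bracket P t : P t -> tree_span P (bracket t).
Proof. by move=> Pt; exists [:: (1, t)]; rewrite ?big_seq1 ?scale1r //= Pt. Qed.

Lemma tree_span_bracketr P Q f g :
  (forall t, P t -> tree_span Q (lieb f (bracket t))) ->
  tree_span P g -> tree_span Q (lieb f g).
Proof.
move=> PQ [s Ps ->]; elim: s Ps => [_|x s IH] /=.
  by rewrite big_nil lieb0r; exact: tree_span0.
case/andP=> Px /IH Qs; rewrite big_cons liebDr liebZr.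
by apply: tree_spanD Qs; apply/tree_spanZ/PQ.
Qed.

Lemma tree_span_bracketl P Q f g :
  (forall t, P t -> tree_span Q (lieb (bracket t) g)) ->
  tree_span P f -> tree_span Q (lieb f g).
Proof.
move=> PQ Pf; rewrite liebC; apply: tree_spanN.
apply: tree_span_bracketr Pf => t Pt.
by rewrite liebC; apply: tree_spanN; exact: PQ.
Qed.

Lemma tree_spanS P Q f : {subset P <= Q} -> tree_span P f -> tree_span Q f.
Proof. by move=> PQ [s Ps ->]; exists s => //; apply: sub_all Ps => x /PQ. Qed.

(** [u] itself is counted only on the right. This is the termination measure of the rewriting below;
    it is finite because the alphabet is finite and lengths are bounded. *)
Lemma below_count_lt (N : nat) (u v : seq I) : (size u <= N)%N -> (u < v)%O ->
  (#|[set s : {bseq N of I} | (s < u :> seq I)%O]| <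
   #|[set s : {bseq N of I} | (s < v :> seq I)%O]|)%N.
Proof.
move=> uN uv; apply/proper_card/properP; split.
  by apply/subsetP => s; rewrite !inE => /lt_trans->.
by exists (Bseq uN); rewrite !inE ?ltxx.
Qed.

(** The outer induction is on total length, the inner one on the number of words below the bound
    [w]. When [Node t1 t2] is not standard, [t1] is some [Node l r] with [yield r < yield t2], and
    $[[l,r],t_2]=[l,[r,t_2]]-[r,[l,t_2]]$. The inner brackets are shorter; expanding them leaves
    brackets of trees whose words are all below [yield t2]. *)
Lemma lieb_lyndon_span_lt (w : seq I) t1 t2 :
  lyndon_tree t1 -> lyndon_tree t2 ->
  (yield t1 <= w)%O -> (yield t2 <= w)%O ->
  tree_span
    [pred t | [&& lyndon_tree t, (yield t < w)%O &
      size (yield t) == (size (yield t1) + size (yield t2))%N]]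
    (lieb (bracket t1) (bracket t2)).
Proof.
have [N] := ubnPeq (size (yield t1) + size (yield t2))%N.
elim/ltn_ind: N w t1 t2 => N IHN w t1 t2 /eqP NE.
have [m] := ubnP #|[set s : {bseq N of I} | (s < w :> seq I)%O]|.
elim: m w t1 t2 NE => // m IHm w t1 t2 NE.
wlog lt12 : t1 t2 NE / (yield t1 < yield t2)%O => [wl mlt T1 T2 le1 le2|].
  have [lt12|lt21|/yield_inj ->//] := ltgtP (yield t1) (yield t2); last first.
  - by rewrite liebb; exact: tree_span0.
  - by rewrite liebC; apply: tree_spanN; apply: wl => //; rewrite addnC.
  - exact: wl.
rewrite ltnS => mle T1 T2 _ le2.
have nodeT : lyndon_tree (Node t1 t2) ->
  tree_span [pred t | [&& lyndon_tree t, (yield t < w)%O & size (yield t) == N]]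
   (lieb (bracket t1) (bracket t2)).
  move=> T12; apply: (@tree_span_bracket _ (Node t1 t2)).
  apply/and3P; split=> //; last by rewrite /= size_cat NE.
  apply: lt_le_trans le2.
  by apply: lyndon_lt_cat; rewrite ?yield_neq0 //; exact: lyndon_treeP.
case: t1 => [a|l r] in NE lt12 T1 nodeT *.
  by apply: nodeT; rewrite /= T2 lt12.
have [le2r|ltr2] := leP (yield t2) (yield r).
  by apply: nodeT; move: T1 lt12 => /= -> ->; rewrite T2.
have /= := T1 => /and4P[Tl Tr ltlr _]; rewrite /= size_cat in NE.
have [gt0l gt0r] := (size_yield_gt0 l, size_yield_gt0 r).
(* The total length is still [N], but the bound drops from [w] to the larger of the two words, so
   the inner induction applies. *)
have step t t' : lyndon_tree t -> lyndon_tree t' ->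
    (yield t < yield t2)%O -> (yield t' < yield t2)%O ->
    (size (yield t) + size (yield t') = N)%N -> tree_span
      [pred t | [&& lyndon_tree t, (yield t < w)%O & size (yield t) == N]]
      (lieb (bracket t) (bracket t')).
  move=> Tt Tt' lt lt' tN; set w' := Order.max (yield t) (yield t').
  have w'w : (w' < w)%O by apply: lt_le_trans le2; rewrite gt_max lt.
  have w'N : (size w' <= N)%N.
    by rewrite /w'; case: leP; rewrite -tN ?leq_addr ?leq_addl.
  apply: tree_spanS (IHm w' t t' tN _ Tt Tt' _ _).
  - by move=> u; rewrite !inE => /and3P[-> /lt_trans-> //].
  - exact: leq_trans (below_count_lt w'N w'w) mle.
  - by rewrite le_max lexx.
  - by rewrite le_max lexx orbT.
have ltl2 := lt_trans ltlr ltr2.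
rewrite /= lieb_leibniz; apply: tree_spanD.
  apply: tree_span_bracketr
    (IHN _ _ (yield t2) r t2 (eqxx _) Tr T2 _ _); last 3 first.
  - by rewrite -NE -addnA -[ltnLHS]add0n ltn_add2r.
  - exact: ltW.
  - exact: lexx.
  by move=> t /and3P[Tt tlt /eqP tN]; apply: step; rewrite // tN addnA.
apply: tree_spanN.
apply: tree_span_bracketr
  (IHN _ _ (yield t2) l t2 (eqxx _) Tl T2 _ _); last 3 first.
- by rewrite -NE -addnA ltn_add2l -[ltnLHS]add0n ltn_add2r.
- exact: ltW.
- exact: lexx.
by move=> t /and3P[Tt tlt /eqP tN]; apply: step; rewrite // tN addnCA addnA.
Qed.

Lemma lieb_lyndon_span t1 t2 : lyndon_tree t1 -> lyndon_tree t2 ->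
  tree_span lyndon_tree (lieb (bracket t1) (bracket t2)).
Proof.
move=> T1 T2; set w := Order.max (yield t1) (yield t2).
apply: tree_spanS (@lieb_lyndon_span_lt w _ _ T1 T2 _ _).
- by move=> t /and3P[].
- by rewrite le_max lexx.
- by rewrite le_max lexx orbT.
Qed.

Lemma freeLie_lyndon_span f : tree_span lyndon_tree f.
Proof.
elim/quotW: f; elim=> [a||s IH|s IHs t IHt|c s IH|s IHs t IHt].
- exact: (@tree_span_bracket _ (Leaf a)).
- exact: tree_span0.
- by rewrite freeLieNE; exact: tree_spanN.
- by rewrite freeLieDE; exact: tree_spanD.
- by rewrite freeLieZE; exact: tree_spanZ.
rewrite freeLieBE; apply: tree_span_bracketl IHs => t1 T1.
by apply: tree_span_bracketr IHt => t2 T2; exact: lieb_lyndon_span.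
Qed.

Lemma seq_argmin (T : eqType) d' (S : orderType d') (F : T -> S) (s : seq T) :
  s != [::] -> exists2 x, x \in s & {in s, forall y, (F x <= F y)%O}.
Proof.
elim: s => [//|x s IH] _; have [->|/IH[y ys ymin]] := eqVneq s [::].
  by exists x => [|y]; rewrite inE // => /eqP->.
have [xy|yx] := leP (F x) (F y).
  exists x => [|z]; rewrite inE ?eqxx // => /predU1P[->//|/ymin].
  exact: le_trans.
exists y => [|z]; rewrite inE ?ys ?orbT // => /predU1P[->|/ymin //].
exact: ltW.
Qed.

Lemma freeLie_lyndon_expansion f : f != 0 ->
  exists (s : seq (bin_tree I)) (c : bin_tree I -> K) t0,
    [/\ uniq s, all lyndon_tree s, f = \sum_(t <- s) c t *: bracket t,
        t0 \in s & c t0 != 0] /\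
    {in s, forall t, c t != 0 -> (yield t0 <= yield t)%O}.
Proof.
have [s Ps ->] := freeLie_lyndon_span f.
pose c t := \sum_(x <- s | x.2 == t) x.1; pose r := undup (map snd s).
have -> : \sum_(x <- s) x.1 *: bracket x.2 = \sum_(t <- r) c t *: bracket t.
  under [RHS]eq_bigr do rewrite scaler_suml.
  rewrite (exchange_big_dep predT) //= [LHS]big_seq [RHS]big_seq.
  apply: eq_bigr => x xs; under eq_bigl do rewrite eq_sym.
  have xr : x.2 \in r by rewrite mem_undup; exact: map_f.
  by rewrite -big_filter (filter_pred1_uniq (undup_uniq _) xr) big_seq1.
move=> f0; have [|t0] := @seq_argmin _ _ _ (@yield I) [seq t <- r | c t != 0].
  apply: contra f0 => /eqP r0; rewrite (bigID (fun t => c t != 0)) /=.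
  rewrite -big_filter r0 big_nil add0r big1 // => t.
  by rewrite negbK => /eqP->; rewrite scale0r.
rewrite mem_filter => /andP[ct0 t0r] t0min; exists r, c, t0; split=> [|t tr ct].
  split; rewrite ?undup_uniq //; apply/allP => t; rewrite mem_undup.
  by case/mapP=> x xs ->; move/allP: Ps; apply.
by apply: t0min; rewrite mem_filter ct.
Qed.

End LyndonSpan.

(** * Derivations of the truncated ring and brackets of pivot elements *)

Section Derivation.
Context {K : comNzRingType} {A : algType K}.
Implicit Types D : der A.
Local Open Scope ring_scope.

Lemma der1 D : D 1 = 0.
Proof.
have := derM D 1 1; rewrite !mulr1 mul1r => E.
by apply: (addrI (D 1)); rewrite addr0 -E.
Qed.

Lemma derD D : {morph D : x y / x + y}.
Proof. exact: linearD. Qed.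

Lemma der0 D : D 0 = 0.
Proof. exact: linear0. Qed.

Lemma der_sum D (J : Type) (s : seq J) (F : J -> A) :
  D (\sum_(i <- s) F i) = \sum_(i <- s) D (F i).
Proof. exact: linear_sum. Qed.

End Derivation.

Section FibonacciDerivations.
Context {K : fieldType}.
Local Open Scope ring_scope.
Hypothesis char2 : 2%N \in [pchar K].
Local Notation R := (truncR K).
Local Notation J := (@sq_ideal K).
Local Notation "'t_ i" := (tvar K i)
  (at level 8, i at level 2, format "''t_' i").
Local Notation "'d_ i" := (partial char2 i)
  (at level 8, i at level 2, format "''d_' i").
Local Notation v := (pivot char2).

Lemma poly_partialCU i j (c : K) (m : {cmonom nat}) :
  poly_partial_fun i (poly_partial_fun j << c *g m >>) =
  << c *+ m j *+ divcm m (ucm j) i *g divcm (divcm m (ucm j)) (ucm i) >>.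
Proof.
apply: etrans (congr1 (poly_partial_fun i) (poly_partialU j c m)) _.
exact: poly_partialU.
Qed.

Lemma poly_partialC i j (p : {malg K[{cmonom nat}]}) :
  poly_partial_fun i (poly_partial_fun j p) =
  poly_partial_fun j (poly_partial_fun i p).
Proof.
have P0 k : poly_partial_fun k 0 = 0 :> {malg K[{cmonom nat}]}.
  by rewrite /poly_partial_fun msupp0 big_seq_fset0.
rewrite [p]monalgE; elim/big_rec: _ => [|m q _ IH]; first by rewrite !P0.
set U : {malg K[{cmonom nat}]} := << _ *g _ >>.
rewrite (poly_partialD i U q) (poly_partialD j U q).
rewrite (poly_partialD i (poly_partial_fun j U) (poly_partial_fun j q)).
rewrite (poly_partialD j (poly_partial_fun i U) (poly_partial_fun i q)).
apply: congr2 IH.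
apply: etrans (poly_partialCU i j _ m) _.
apply: etrans (esym (poly_partialCU j i _ m)).
rewrite !divcmE !ucmE; have [->//|_] := eqVneq i j.
rewrite !subn0 mulrnAC.
suff -> : divcm (divcm m (ucm j)) (ucm i) =
          divcm (divcm m (ucm i)) (ucm j) by [].
by apply/eqP/cmP => k; rewrite !divcmE subnAC.
Qed.

Lemma partial_qproj i (p : {malg K[{cmonom nat}]}) :
  'd_i (qproj J p) = qproj J (poly_partial K i p).
Proof. exact: quot_derE. Qed.

Lemma partialC i j (x : R) : 'd_i ('d_j x) = 'd_j ('d_i x).
Proof.
have [p xE] := qproj_surj (x : quot_alg J).
have -> : x = qproj J p by [].
rewrite (partial_qproj i p) (partial_qproj j p).
rewrite (partial_qproj i (poly_partial K j p)).
rewrite (partial_qproj j (poly_partial K i p)).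
exact: (congr1 (qproj J) (poly_partialC i j p)).
Qed.

Lemma partial_prod i m n : (i < m)%N -> 'd_i (\prod_(j < n) 't_(m + j)) = 0.
Proof.
move=> im; elim: n => [|n IH]; first by rewrite big_ord0 der1.
rewrite big_ord_recr /= derM IH mul0r add0r partial_tvar.
by rewrite ltn_eqF ?mulr0 // ltn_addr.
Qed.

Lemma pivotE i x N : (forall k, (N <= k)%N -> 'd_k x = 0) ->
  v i x = \sum_(k < N) (\prod_(j < k) 't_(i.-1 + j)) * 'd_(i + k) x.
Proof. exact: pivot_sum_funE. Qed.

(** The coefficients of $v_m$ involve only $t_j$ with $j\ge m-1>i$, and partial derivatives
    commute. *)
Lemma pivot_partialC i m x : (i.+2 <= m)%N -> 'd_i (v m x) = v m ('d_i x).
Proof.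
move=> im; have [N HN] := partial_bound char2 x.
have HN' k : (N <= k)%N -> 'd_k ('d_i x) = 0.
  by move=> /HN kx; rewrite partialC kx der0.
rewrite (pivotE m HN) (pivotE m HN') der_sum.
apply: eq_bigr => k _; rewrite derM partial_prod ?mul0r ?add0r 1?partialC //.
by case: m im.
Qed.

Lemma pivot_tvar m i : (i < m)%N -> v m 't_i = 0.
Proof.
move=> im; have [N HN] := partial_bound char2 't_i.
rewrite (pivotE m HN) big1 // => k _.
by rewrite partial_tvar gtn_eqF ?mulr0 // ltn_addr.
Qed.

(** In $v_{i+1}=\partial_{i+1}+t_iv_{i+2}$ the second term commutes with $v_{i+2}$, which kills
    $t_i$. In $v_{i+2}=\partial_{i+2}+t_{i+1}v_{i+3}$, bracketing with $\partial_{i+1}$ only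
    differentiates the factor $t_{i+1}$. *)
Lemma lieb_pivot1 i x : lieb (v i.+1) (v i.+2) x = v i.+3 x.
Proof.
rewrite der_liebE pivot_rec [v i.+1 x]pivot_rec derD derM.
rewrite (pivot_tvar (ltnW (ltnSn i.+1))) mul0r add0r opprD addrACA subrr addr0.
rewrite (pivot_rec char2 i.+1 x) derD derM partial_tvar eqxx mul1r.
rewrite [v i.+2 ('d_i.+1 x)]pivot_rec pivot_partialC // partialC.
by rewrite addrCA addrK.
Qed.

Lemma pivot_fibonacci_lie i : fibonacci_lie char2 (v i.+1).
Proof.
have [_ _ _ LB] : lie_subalgebra (fibonacci_lie char2).
  exact: lie_generated_subalgebra.
elim/ltn_ind: i => -[|[|i]] IH.
- by move=> U [_]; apply; left.
- by move=> U [_]; apply; right.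
have -> : v i.+3 = lieb (v i.+1) (v i.+2).
  by apply: der_eqP => x; rewrite lieb_pivot1.
by apply: LB; apply: IH.
Qed.

(** Here $\partial_{i+1}$ commutes with $v_{i+3}$, and $v_{i+3}$ kills $t_i$, so only
    $t_i[v_{i+2},v_{i+3}]$ survives. *)
Lemma lieb_pivot2 i x : lieb (v i.+1) (v i.+3) x = 't_i * v i.+4 x.
Proof.
rewrite der_liebE pivot_rec [v i.+1 x]pivot_rec derD derM.
rewrite (pivot_tvar (leqW (leqW (ltnSn i)))).
rewrite mul0r add0r pivot_partialC // opprD addrACA subrr add0r -mulrBr.
by rewrite -der_liebE lieb_pivot1.
Qed.

(** * The augmentation of $R$ and linear coefficients *)

Definition aug (x : R) : K := mcoeff mone (repr x).

Lemma aug_qproj (p : {malg K[{cmonom nat}]}) :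
  aug (qproj J p) = mcoeff mone p.
Proof.
apply/eqP; rewrite -subr_eq0 -raddfB.
have : repr (qproj J p) - p \in J.
  by rewrite -qproj_eq qprojK.
move: (repr _ - p) => q /asboolP[s ->]; rewrite raddf_sum big1 // => y _.
by rewrite /= (mcoeff1g_is_multiplicative _ _).1 rmorphXn /= mcoeffU cm1_eq1
           expr0n mulr0.
Qed.

Lemma augD : {morph aug : x y / x + y}.
Proof.
move=> x y; have [p ->] := qproj_surj (x : quot_alg J).
have [q ->] := qproj_surj (y : quot_alg J).
have -> : qproj J p + qproj J q = qproj J (p + q) by rewrite rmorphD.
by rewrite !aug_qproj raddfD.
Qed.

Lemma augM : {morph aug : x y / x * y}.
Proof.
move=> x y; have [p ->] := qproj_surj (x : quot_alg J).
have [q ->] := qproj_surj (y : quot_alg J).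
have -> : qproj J p * qproj J q = qproj J (p * q) by rewrite rmorphM.
rewrite !aug_qproj; exact: (mcoeff1g_is_multiplicative _ _).1.
Qed.

Lemma augZ a x : aug (a *: x) = a * aug x.
Proof.
have [p ->] := qproj_surj (x : quot_alg J).
have -> : a *: qproj J p = qproj J (a *: p) by rewrite qprojZ.
by rewrite !aug_qproj mcoeffZ.
Qed.

Lemma aug1 : aug 1 = 1.
Proof.
have -> : 1 = qproj J 1 by rewrite rmorph1.
by rewrite aug_qproj rmorph1.
Qed.

Lemma aug_tvar i : aug 't_i = 0.
Proof. by rewrite aug_qproj mcoeffU cm1_eq1. Qed.

(* [shift j] is t_(4j) v_(4j+4), which acts on the cotangent space of R at 0  *)
(* as a matrix unit.                                                          *)
Definition shift j : der R := lieb (v (4 * j).+1) (v (4 * j).+3).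

(** This is the coefficient of $t_{4i}$ in [x]. *)
Definition lincoeff i x : K := aug ('d_(4 * i) x).

(** At the origin only the derivative of the factor $t_{4j}$ survives, and $v_{4j+4}$ reduces to
    $\partial_{4j+4}$. The spacing 4 makes the target index of one unit the source of the next. *)
Lemma lincoeff_shift i j x :
  lincoeff i (shift j x) = (j == i)%:R * lincoeff i.+1 x.
Proof.
rewrite /lincoeff lieb_pivot2 derM augD !augM partial_tvar.
rewrite aug_tvar mul0r addr0 eqn_pmul2l // eq_sym.
have [->|_] := eqVneq j i; last by rewrite -[0%:R](scale0r 1) augZ !mul0r.
by rewrite aug1 !mul1r pivot_rec augD augM aug_tvar mul0r addr0 mulnS.
Qed.

Lemma lincoeff_tvar i j : lincoeff i 't_(4 * j) = (i == j)%:R.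
Proof.
rewrite /lincoeff partial_tvar eqn_pmul2l //; case: eqP => _; first exact: aug1.
by rewrite -[0%:R](scale0r 1) augZ mul0r.
Qed.

End FibonacciDerivations.

(** * Substitutions that read off the coefficient of a word *)

Section Evaluation.
Context {K : fieldType} {d : Order.disp_t} {I : finOrderType d}.
Local Open Scope ring_scope.
Hypothesis char2 : 2%N \in [pchar K].
Local Notation R := (truncR K).
Implicit Types (w : seq I) (a : I) (t : bin_tree I) (x : R).

(** The test on [take 1 (drop j w)] says that letter [j] of [w] is [a]; it needs no default letter
    and fails past the end of [w]. *)
Definition word_der w a : der R :=
  \sum_(j < size w | take 1 (drop j w) == [:: a]) shift char2 j.

Lemma word_der_fibonacci_lie w a : fibonacci_lie char2 (word_der w a).
Proof.
have [L0 LD _ LB] : lie_subalgebra (fibonacci_lie char2).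
  exact: lie_generated_subalgebra.
apply: (big_ind (fibonacci_lie char2)) => // j _.
by apply: LB; exact: pivot_fibonacci_lie.
Qed.

Lemma lincoeffD i : {morph lincoeff char2 i : x y / x + y}.
Proof. by move=> x y; rewrite /lincoeff derD augD. Qed.

Lemma lincoeffZ i c x : lincoeff char2 i (c *: x) = c * lincoeff char2 i x.
Proof. by rewrite /lincoeff -augZ; congr aug; exact: linearZ. Qed.

Lemma lincoeff0 i : lincoeff char2 i 0 = 0.
Proof. by rewrite -(scale0r 0) lincoeffZ mul0r. Qed.

Lemma lincoeff_word_der w a i x : lincoeff char2 i (word_der w a x) =
  (take 1 (drop i w) == [:: a])%:R * lincoeff char2 i.+1 x.
Proof.
have -> : word_der w a x =
    \sum_(j < size w | take 1 (drop j w) == [:: a]) shift char2 j x.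
  rewrite /word_der; elim/big_rec2: _ => [|j y D _ <-]; first exact: der0E.
  exact: derDE.
rewrite (big_morph _ (lincoeffD i) (lincoeff0 i)).
under eq_bigr do rewrite lincoeff_shift.
have [iw|wi] := ltnP i (size w).
  rewrite big_mkcond (bigD1 (Ordinal iw)) //= big1 ?addr0.
    by rewrite eqxx mul1r; case: ifP => _; rewrite ?mul1r ?mul0r.
  by move=> j; rewrite -val_eqE /= => /negbTE->; rewrite mul0r if_same.
rewrite big1 ?drop_oversize ?mul0r // => j _.
by rewrite ltn_eqF ?mul0r // (leq_trans _ wi).
Qed.

Lemma take_slice (T : Type) (s : seq T) i m n :
  take (m + n) (drop i s) = take m (drop i s) ++ take n (drop (i + m) s).
Proof. by rewrite takeD drop_drop addnC. Qed.

(* [c] is the coefficient of the factor of [w] at position [i] in the         *)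
(* associative expansion of [bracket t], whose least word is [yield t].       *)
Lemma lincoeff_bracket w t i : lyndon_tree t -> exists c : K,
  [/\ forall x, lincoeff char2 i (lie_eval (word_der w) (bracket t) x) =
        c * lincoeff char2 (i + size (yield t)) x,
      c != 0 -> let s := take (size (yield t)) (drop i w) in
        size s = size (yield t) /\ (yield t <= s)%O
    & take (size (yield t)) (drop i w) = yield t -> c = 1].
Proof.
elim: t i => [a|l IHl r IHr] i.
  exists (take 1 (drop i w) == [:: a])%:R; split=> [x||/= ->].
  - by rewrite /= lie_eval_var lincoeff_word_der addn1.
  - by have [->|] := eqVneq (take 1 (drop i w)) [:: a]; rewrite ?eqxx.
  - by rewrite eqxx.
case/and4P=> Tl Tr lt_lr _ /=; rewrite size_cat.
(* The commutator reads [l] then [r] from position [i], minus [r] then [l]; each tree is thus met at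
   two positions. *)
have [cl [El lel l1]] := IHl i Tl.
have [cr [Er ler r1]] := IHr (i + size (yield l))%N Tr.
have [cl' [El' lel' l1']] := IHl (i + size (yield r))%N Tl.
have [cr' [Er' ler' r1']] := IHr i Tr.
(* Factors seen by the reversed product are at least [yield r ++ yield l], hence strictly above the
   word of the tree, whose coefficient stays 1. *)
have ltrl : (yield l ++ yield r < yield r ++ yield l)%O.
  apply: lt_le_trans (lexi_catr _ _).
  by apply: lyndon_lt_cat lt_lr; rewrite ?yield_neq0 //; exact: lyndon_treeP.
have lr_le : cl * cr != 0 ->
    let s := take (size (yield l) + size (yield r)) (drop i w) in
    size s = (size (yield l) + size (yield r))%N /\ (yield l ++ yield r <= s)%O.
  rewrite mulf_eq0 negb_or => /andP[/lel[sl lel1] /ler[sr ler1]] /=.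
  by rewrite take_slice size_cat sl sr lexi_cat_size.
have rl_le : cr' * cl' != 0 ->
    let s := take (size (yield l) + size (yield r)) (drop i w) in
    size s = (size (yield l) + size (yield r))%N /\ (yield l ++ yield r < s)%O.
  rewrite mulf_eq0 negb_or => /andP[/ler'[sr ler1] /lel'[sl lel1]] /=.
  rewrite addnC take_slice size_cat sl sr; split=> //.
  by apply: (lt_le_trans ltrl); exact: lexi_cat_size.
exists (cl * cr - cr' * cl'); split=> [x|nz|sE].
- rewrite lie_eval_br der_liebE lincoeffD -scaleN1r lincoeffZ mulN1r.
  rewrite El Er Er' El' !mulrA mulrBl !addnA.
  by rewrite [(i + _ + size (yield l))%N]addnAC.
- have [lr0|/lr_le//] := eqVneq (cl * cr) 0.
  have rl0 : cr' * cl' != 0 by apply: contra nz => /eqP->; rewrite lr0 subr0.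
  by have [sz /ltW] := rl_le rl0.
- have /eqP : take (size (yield l)) (drop i w) ++
      take (size (yield r)) (drop (i + size (yield l)) w) = yield l ++ yield r.
    by rewrite -take_slice.
  have -> : cr' * cl' = 0.
    by apply/eqP; apply: contraT => /rl_le[_]; rewrite sE ltxx.
  have sl : size (take (size (yield l)) (drop i w)) = size (yield l).
    apply/size_takel/(leq_trans (leq_addr (size (yield r)) _)).
    by rewrite -size_cat -sE size_take_min geq_minr.
  by rewrite eqseq_cat // => /andP[/eqP/l1-> /eqP/r1->]; rewrite mulr1 subr0.
Qed.

End Evaluation.

Local Open Scope ring_scope.

Theorem theorem14 (K : fieldType) (char2 : 2%N \in [pchar K]) :
  ~ exists (n : nat) (f : freeLie K 'I_n),
      f <> 0 /\
      forall a : 'I_n -> der (truncR K),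
        (forall i, fibonacci_lie char2 (a i)) -> lie_eval a f = 0.
Proof.
case=> n [f [/eqP f0 fvan]].
have [s [c [t0 [[us sL fE t0s ct0] t0min]]]] := freeLie_lyndon_expansion f0.
set w := yield t0 in t0min.
have f1 := fvan _ (@word_der_fibonacci_lie _ _ _ char2 w).
(* The argument $t_{4|w|}$ selects the words of length $|w|$. *)
pose phi (g : freeLie K 'I_n) : K :=
  lincoeff char2 0 (lie_eval (word_der char2 w) g (tvar K (4 * size w))).
have phi0 : phi f = 0 by rewrite /phi f1 der0E lincoeff0.
have phiD g h : phi (g + h) = phi g + phi h.
  by rewrite /phi linearD derDE lincoeffD.
have phiZ b g : phi (b *: g) = b * phi g.
  by rewrite /phi linearZ /= derZE lincoeffZ.
have phit t : t \in s -> c t != 0 -> phi (bracket t) = (t == t0)%:R.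
  move=> ts ct; have Tt := allP sL t ts; have T0 := allP sL t0 t0s.
  have [k [kE kn k1]] := lincoeff_bracket char2 w 0 Tt.
  rewrite drop0 in kn k1.
  rewrite /phi kE lincoeff_tvar add0n; have [tt0|ntt0] := eqVneq t t0.
    by rewrite tt0 eqxx mulr1 k1 // tt0 take_size.
  (* A tree with a word of another length gives 0. For equal lengths, a nonzero [k] would force
     [yield t <= w], hence [t = t0] by minimality of [w]. *)
  have [st|_] := eqVneq; last by rewrite mulr0.
  have [->|/kn[_]] := eqVneq k 0; first by rewrite mul0r.
  rewrite st take_size => le_tw; case/eqP: ntt0; apply: yield_inj => //.
  by apply: le_anti; rewrite le_tw t0min.
have phiS : phi f = \sum_(t <- s) c t * phi (bracket t).
  rewrite fE; elim: (s) => [|t r IH].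
    by rewrite !big_nil /phi linear0 der0E lincoeff0.
  by rewrite !big_cons phiD phiZ IH.
move: phi0; rewrite phiS (bigD1_seq t0) //= phit // eqxx mulr1 big_seq_cond.
rewrite big1 ?addr0; first by move/eqP; rewrite (negbTE ct0).
move=> t /andP[ts /negbTE tt0].
have [->|ct] := eqVneq (c t) 0; first by rewrite mul0r.
by rewrite phit // tt0 mulr0.
Qed.
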